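(* Let $(T,d)$ be a compact metric tree, embedded into $L_1(\mu_T)$ by the semicanonical embedding $U(x)=\chi_{[p,x]}$, where $p\in T$ is a fixed base point. Let $x_1,\dots,x_n\in T$, let $\alpha_1,\dots,\alpha_n>0$ with $\sum_{k=1}^n\alpha_k=1$, and let $\tilde x^{(\alpha)}=\sum_{k=1}^n\alpha_k U(x_k)\in L_1(\mu_T)$. For $x_0\in T$, the following are equivalent: (1) $x_0\in\mathbf{P}(\tilde x^{(\alpha)})$. (2) $d(x_0,x)\le\sum_{k=1}^n\alpha_k d(x_k,x)$ for every $x\in T$.
   Context: A metric segment $[x,y]$ in a metric space is the image of an isometric embedding $\gamma:[a,b]\to M$ of a real interval with $\gamma(a)=x$, $\gamma(b)=y$. A metric space $T$ is a metric tree if for all $x,y,z\in T$: (1) there is a unique metric segment $[x,y]$ from $x$ to $y$, and (2) $[x,z]\cap[z,y]=\{z\}$ implies $[x,z]\cup[z,y]=[x,y]$. The measure $\mu_T$: for $x,y\in T$ let $\phi_{xy}:[0,d(x,y)]\to[x,y]$ be the isometry with $\phi_{xy}(0)=x$. A set $S\subset T$ is measurable if $\phi_{xy}^{-1}(S)$ is Lebesgue measurable for all $x,y\in T$. For measurable $S$ put $\mu_{[x,y]}(S)=\lambda(\phi_{xy}^{-1}(S))$ with $\lambda$ Lebesgue measure; for a finite union $F=\bigcup_{k=1}^m[x_k,y_k]$ of pairwise disjoint metric segments put $\mu_F(S)=\sum_{k=1}^m\mu_{[x_k,y_k]}(S)$; and $\mu_T(S)=\sup_F\mu_F(S)$ over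 all such $F$. This is a measure with $\mu_T([x,y])=d(x,y)$, and $x\mapsto\chi_{[p,x]}$ is an isometric embedding of $T$ into $L_1(\mu_T)$. For an isometric embedding $U$ of $T$ into a normed space $X$ (points of $T$ being identified with their images) and $\tilde x\in X$, $\mathbf{P}(\tilde x)$ denotes the set of all points $x_0\in T$ for which there is a contractive (i.e. $1$-Lipschitz) retraction $\pi$ from $X$ onto $U(T)$ with $\pi(\tilde x)=U(x_0)$. *)

(* Defs.v *)
From HB Require Import structures.
From mathcomp Require Import all_boot all_order all_algebra.
From mathcomp Require Import all_classical all_reals all_analysis.
From mathcomp Require Import measurable_realfun lra.

Set Implicit Arguments.
Unset Strict Implicit.
Unset Printing Implicit Defensive.

Import Order.TTheory GRing.Theory Num.Theory.
Import numFieldNormedType.Exports.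

Local Open Scope classical_set_scope.
Local Open Scope ring_scope.

(* The library type LfunType consists of functions and carries no norm;
   [L1 mu] is its quotient by equality almost everywhere, as a normed space. *)
Section L1.
Context {d : measure_display} {T : measurableType d} {R : realType}.
Variable mu : {measure set T -> \bar R}.

Definition L1fun := LfunType mu (lexx (1 : \bar R)%E).

Definition ae_null : {pred L1fun} :=
  fun f => `[< (f : T -> R) = (fun=> 0) %[ae mu] >].

Lemma ae_nullP (f : L1fun) :
  reflect ((f : T -> R) = (fun=> 0) %[ae mu]) (f \in ae_null).
Proof. exact: asboolP. Qed.

Let L1funBE (f g : L1fun) x : (f - g) x = f x - g x. Proof. by []. Qed.

Let L1funZE a (f : L1fun) x : (a *: f) x = a * f x. Proof. by []. Qed.

Lemma ae_null_zmod_closed : zmod_closed ae_null.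
Proof.
split=> [|f g /ae_nullP f0 /ae_nullP g0]; first by apply/ae_nullP; exact: aeW.
apply/ae_nullP; move: f0 g0; apply: filterS2 => x f0 g0 Dx.
by rewrite L1funBE f0// g0// subr0.
Qed.

HB.instance Definition _ :=
  GRing.isZmodClosed.Build L1fun ae_null ae_null_zmod_closed.

Definition L1 : Type := Quotient.quot ae_null.
HB.instance Definition _ := GRing.Zmodule.on L1.
HB.instance Definition _ := EqQuotient.on L1.

Local Open Scope quotient_scope.

Definition L1class (f : L1fun) : L1 := \pi_L1 f.

Lemma L1class_eqP (f g : L1fun) :
  (L1class f = L1class g) <-> (f : T -> R) = g %[ae mu].
Proof.
rewrite /L1class; split.
  move/eqP; rewrite piE => /ae_nullP; apply: filterS => x h Dx.
  by apply/eqP; rewrite -subr_eq0; apply/eqP; exact: h.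
move=> h; apply/eqP; rewrite piE; apply/ae_nullP.
by move: h; apply: filterS => x h Dx; rewrite L1funBE h// subrr.
Qed.

Lemma L1classD (f g : L1fun) : L1class (f + g) = L1class f + L1class g.
Proof. by rewrite /L1class !piE. Qed.

Lemma L1class_repr (f : L1) : L1class (repr f) = f.
Proof. exact: reprK. Qed.

Lemma repr_L1class (f : L1fun) : (repr (L1class f) : T -> R) = f %[ae mu].
Proof. by apply/L1class_eqP; rewrite L1class_repr. Qed.

Definition L1scale (a : R) (f : L1) : L1 := L1class (a *: repr f).

Lemma L1scale_class a (f : L1fun) : L1scale a (L1class f) = L1class (a *: f).
Proof.
apply/L1class_eqP; have := repr_L1class f.
by apply: filterS => x /(_ I) h _; rewrite !L1funZE h.
Qed.

Lemma L1scaleA a b (f : L1) : L1scale a (L1scale b f) = L1scale (a * b) f.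
Proof. by rewrite -(L1class_repr f) !L1scale_class scalerA. Qed.

Lemma L1scale1 : left_id 1 L1scale.
Proof. by move=> f; rewrite -(L1class_repr f) L1scale_class scale1r. Qed.

Lemma L1scaleDr : right_distributive L1scale +%R.
Proof.
move=> a f g; rewrite -(L1class_repr f) -(L1class_repr g).
by rewrite -L1classD !L1scale_class scalerDr L1classD.
Qed.

Lemma L1scaleDl f : {morph L1scale^~ f : a b / a + b}.
Proof.
move=> a b; rewrite -(L1class_repr f) !L1scale_class.
by rewrite scalerDl L1classD.
Qed.

HB.instance Definition _ := GRing.Zmodule_isLmodule.Build R L1
  L1scaleA L1scale1 L1scaleDr L1scaleDl.

Definition L1norm (f : L1) : R := fine ('N[mu]_1[EFin \o (repr f : L1fun)])%E.

Let measurable_abse (f : T -> R) : measurable_fun [set: T] f ->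
  measurable_fun [set: T] (abse \o (EFin \o f)).
Proof. by move=> mf; apply: measurableT_comp => //; exact/measurable_EFinP. Qed.

Lemma L1norm_class (f : L1fun) : L1norm (L1class f) = fine ('N[mu]_1[EFin \o f])%E.
Proof.
rewrite /L1norm !Lnorm1; congr fine; apply: ae_eq_integral => //.
- exact: measurable_abse.
- exact: measurable_abse.
by have := repr_L1class f; apply: filterS => x /(_ I) h _ /=; rewrite h.
Qed.

Lemma L1normD f g : L1norm (f + g) <= L1norm f + L1norm g.
Proof.
rewrite -(L1class_repr f) -(L1class_repr g) -L1classD !L1norm_class.
exact: ler_LnormD.
Qed.

Lemma L1normZ a f : L1norm (a *: f) = `|a| * L1norm f.
Proof.
rewrite -(L1class_repr f) [_ *: _]L1scale_class !L1norm_class.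
apply: EFin_inj; rewrite EFinM !finite_norm_fine.
exact: LnormZ.
Qed.

Lemma L1norm_eq0 f : L1norm f = 0 -> f = 0.
Proof.
rewrite -(L1class_repr f) L1norm_class => /fine_Lnormr_eq0 h.
have -> : 0 = L1class 0 by rewrite /L1class piE.
by apply/L1class_eqP; apply: h.
Qed.

HB.instance Definition _ := Lmodule_isNormed.Build R L1
  L1normD L1normZ L1norm_eq0.

End L1.
Section lebesgue_line.
Context {R : realType}.
Implicit Types (A B K I : set R) (g : R -> R).

(* The Caratheodory sets of the outer Lebesgue measure, i.e. the completion of
   the Borel sets (completed_caratheodory_measurable). *)
Definition lebesgue_measurable A : Prop :=
  (((wlength idfun)^*)%mu.-cara.-measurable A).

Local Notation lam := (@completed_lebesgue_measure R).

Lemma interval_lebesgue_measurable I :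
  is_interval I -> lebesgue_measurable I.
Proof.
by move=> /is_interval_measurable mI; exact: sub_caratheodory.
Qed.

Lemma lam0 : lam set0 = 0%E. Proof. exact: measure0. Qed.

Lemma lam_ge0 A : (0 <= lam A)%E. Proof. exact: mu_ext_ge0. Qed.

Lemma le_lam A B : A `<=` B -> (lam A <= lam B)%E.
Proof. exact: (@le_mu_ext _ (ocitv_type R) R (wlength idfun) A B). Qed.

Lemma lam_bigcup (A : nat -> set R) :
  (lam (\bigcup_n A n) <= \sum_(0 <= n <oo) lam (A n))%E.
Proof. exact: (@mu_ext_sigma_subadditive _ (ocitv_type R) R (wlength idfun) (wlength_ge0 idfun) A). Qed.

Lemma lamU A B : (lam (A `|` B) <= lam A + lam B)%E.
Proof. exact: (@outer_measureU2 _ _ ((wlength idfun)^*)%mu). Qed.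

Lemma lam_itv (a b : R) : a <= b -> lam `[a, b] = (b - a)%:E.
Proof.
move=> ab; have := @lebesgue_measure_itv R `[a, b].
rewrite /= lte_fin.
move: ab; rewrite le_eqVlt => /predU1P[->|ab].
  by rewrite ltxx subrr.
by rewrite ab.
Qed.

Lemma lam_diam A (r : R) : 0 <= r -> (forall s t, A s -> A t -> t - s <= r) ->
  (lam A <= r%:E)%E.
Proof.
move=> r0 Ar; have [->|/set0P A0] := eqVneq A set0.
  by rewrite lam0 lee_fin.
have [s0 As0] := A0.
have hs : has_sup A by split=> //; exists (s0 + r) => t At; have := Ar _ _ As0 At; lra.
have hi : has_inf A by split=> //; exists (s0 - r) => t At; have := Ar _ _ At As0; lra.
have sr : sup A - r <= inf A.
  apply: lb_le_inf => // s As; suff : sup A <= s + r by lra.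
  by apply: ge_sup => // t At; have := Ar _ _ As At; lra.
have is0 : inf A <= sup A.
  by rewrite (le_trans (ge_inf hi.2 As0))// (ub_le_sup hs.2).
apply: (@le_trans _ _ (lam `[inf A, sup A])).
  by apply: le_lam => t At /=; rewrite in_itv/= (ge_inf hi.2)//= (ub_le_sup hs.2).
by rewrite lam_itv// lee_fin; lra.
Qed.

(* A 1-Lipschitz map does not increase the outer Lebesgue measure; this gives
   invariance under isometries for arbitrary subsets of the line. *)
Lemma lam_lip A g :
  (forall s t, A s -> A t -> `|g s - g t| <= `|s - t|) ->
  (lam (g @` A) <= lam A)%E.
Proof.
move=> gA; apply: le_ereal_inf_tmp => _ [F [mF AF] <-].
apply: (@le_trans _ _ (lam (\bigcup_k (g @` (A `&` F k))))).
  apply: le_lam => _ [t At <-]; have [k _ Fkt] := AF _ At.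
  by exists k => //; exists t.
apply: (le_trans (lam_bigcup _)); apply: lee_nneseries.
  by move=> *; exact: lam_ge0.
move=> k _; have [[a b] _ /= Fk] := mF k.
rewrite -Fk; have [ba|ab] := leP b a.
  by rewrite set_itv_ge -?leNgt//= setI0 image_set0 lam0 wlength0.
rewrite wlength_itv_bnd ?(ltW ab)//=.
apply: lam_diam; first by rewrite subr_ge0 ltW.
move=> _ _ [s [As /= si] <-] [t [At /= ti] <-].
rewrite (le_trans (ler_norm _))// (le_trans (gA _ _ At As))//.
by move: si ti; rewrite !in_itv/= ler_norml => /andP[? ?] /andP[? ?]; lra.
Qed.

Lemma lam_isom A g :
  (forall s t, A s -> A t -> `|g s - g t| = `|s - t|) ->
  lam (g @` A) = lam A.
Proof.
move=> gA; apply/eqP; rewrite eq_le; apply/andP; split.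
  by apply: lam_lip => s t As At; rewrite gA.
pose h r := xget 0 [set s | A s /\ g s = r].
have hP s : A s -> h (g s) = s.
  move=> As; have [Ah ghs] : A (h (g s)) /\ g (h (g s)) = g s.
    by apply: (@xgetPex _ 0 [set s' | A s' /\ g s' = g s]); exists s.
  by apply/eqP; rewrite -subr_eq0 -normr_eq0 -gA// ghs subrr normr0.
have {1}<- : h @` (g @` A) = A.
  rewrite image_comp; apply/seteqP; split=> [_ [s As <-]|s As] /=.
    by rewrite hP.
  by exists s => //=; rewrite hP.
apply: lam_lip => _ _ [s As <-] [t At <-].
by rewrite !hP// gA.
Qed.

Lemma interval_inner K (a b e : R) : is_interval K -> K `<=` `[a, b] -> 0 < e ->
  K !=set0 -> exists c d, [/\ c <= d, K c, K d & (lam (K `\` `[c, d]) <= e%:E)%E].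
Proof.
move=> iK Kab e0 [k0 Kk0]; have e20 : 0 < e / 2 by rewrite divr_gt0.
have hi : has_inf K.
  by split; [exists k0|exists a => t /Kab/=; rewrite in_itv/= => /andP[]].
have hs : has_sup K.
  by split; [exists k0|exists b => t /Kab/=; rewrite in_itv/= => /andP[]].
have [c' Kc' c'e] := inf_adherent e20 hi.
have [d' Kd' d'e] := sup_adherent e20 hs.
exists (Num.min c' k0), (Num.max d' k0).
have Kc : K (Num.min c' k0) by case: (leP c' k0).
have Kd : K (Num.max d' k0) by case: (leP d' k0).
split=> //; first by apply: (@le_trans _ _ k0); rewrite ?ge_min ?le_max lexx orbT.
set c := Num.min _ _ in Kc *; set d := Num.max _ _ in Kd *.
have cc' : c <= c' by rewrite ge_min lexx.
have dd' : d' <= d by rewrite le_max lexx.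
have ic : inf K <= c by rewrite (ge_inf hi.2).
have ds : d <= sup K by rewrite (ub_le_sup hs.2).
apply: (@le_trans _ _ (lam (`[inf K, c] `|` `[d, sup K]))).
  apply: le_lam => t [Kt /=]; rewrite !in_itv/= => /negP.
  have -> : inf K <= t by rewrite (ge_inf hi.2).
  have -> : t <= sup K by rewrite (ub_le_sup hs.2).
  by rewrite negb_and -!ltNge andbT/= => /orP[] /ltW ->; [left|right].
apply: (le_trans (lamU _ _)); rewrite !lam_itv// -EFinD lee_fin.
lra.
Qed.

Definition disjseq (T : Type) (s : seq (set T)) : bool :=
  pairwise (fun A B : set T => `[< A `&` B = set0 >]) s.

Lemma disjoint_sub (T : Type) (A A' B B' : set T) : A' `<=` A -> B' `<=` B ->
  A `&` B = set0 -> A' `&` B' = set0.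
Proof. by move=> AA BB AB0; rewrite -subset0 => x [/AA Ax /BB Bx]; rewrite -AB0. Qed.

Lemma disjseq_map (T : Type) (s : seq (set T)) (f : set T -> set T) :
  (forall C, f C `<=` C) -> disjseq s -> disjseq (map f s).
Proof.
move=> fs; rewrite /disjseq pairwise_map; apply: sub_pairwise => A B /asboolP AB.
by apply/asboolP; apply: disjoint_sub AB.
Qed.

Lemma intervalI I K : is_interval I -> is_interval K -> is_interval (I `&` K).
Proof.
by move=> II IK x y [Ix Kx] [Iy Ky] z xzy; split; [exact: (II x y)|exact: (IK x y)].
Qed.

Lemma interval_setD (a b : R) (Is : seq (set R)) :
  (forall I, I \in Is -> is_interval I) ->
  exists Ks : seq (set R), [/\ forall K, K \in Ks -> is_interval K, disjseq Ks &
    forall t, (exists2 K, K \in Ks & K t) <->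
      (`[a, b]%classic t /\ forall I, I \in Is -> ~ I t)].
Proof.
elim: Is => [_|I Is IH Iint].
  exists [:: `[a, b]%classic]; split=> //.
    by move=> K; rewrite inE => /eqP ->; exact: interval_is_interval.
  move=> t; split=> [[K]|[abt _]]; first by rewrite inE => /eqP ->.
  by exists `[a, b]%classic => //; rewrite inE.
have [|Ks [Kint Kdisj KsP]] := IH.
  by move=> J JIs; apply: Iint; rewrite inE JIs orbT.
have II : is_interval I by apply: Iint; rewrite inE eqxx.
have [I0|/set0P[i0 Ii0]] := eqVneq I set0.
  exists Ks; split=> // t; rewrite KsP; split=> -[abt tIs]; split=> // J.
    by rewrite inE => /predU1P[->|/tIs//]; rewrite I0.
  by move=> JIs; apply: tIs; rewrite inE JIs orbT.
pose L := [set t | forall s, I s -> t < s].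
pose G := [set t | forall s, I s -> s < t].
have Lint : is_interval L.
  by move=> x y Lx Ly z /andP[_ zy] s /Ly; exact: le_lt_trans.
have Gint : is_interval G.
  by move=> x y Gx Gy z /andP[xz _] s /Gx sx; exact: lt_le_trans sx xz.
exists (map (setI L) Ks ++ map (setI G) Ks); split.
- by move=> K; rewrite mem_cat => /orP[] /mapP[J JKs ->];
    apply: intervalI => //; exact: Kint.
- rewrite /disjseq pairwise_cat -/(disjseq _) -/(disjseq _).
  rewrite !disjseq_map ?andbT//; [|by move=> ?; exact: subIsetr..].
  apply/allrelP => _ _ /mapP[J _ ->] /mapP[J' _ ->]; apply/asboolP.
  rewrite -subset0 => t [[Lt _] [Gt _]].
  by have := lt_trans (Lt _ Ii0) (Gt _ Ii0); rewrite ltxx.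
- move=> t; split.
    move=> [K]; rewrite mem_cat => /orP[] /mapP[J JKs ->] [LGt Jt].
      have [abt tIs] := (KsP t).1 (ex_intro2 _ _ J JKs Jt).
      split=> // J'; rewrite inE => /predU1P[->|/tIs//].
      by move=> /LGt; rewrite ltxx.
    have [abt tIs] := (KsP t).1 (ex_intro2 _ _ J JKs Jt).
    split=> // J'; rewrite inE => /predU1P[->|/tIs//].
    by move=> /LGt; rewrite ltxx.
  move=> [abt tIs]; have [|K KKs Kt] := (KsP t).2.
    by split=> // J JIs; apply: tIs; rewrite inE JIs orbT.
  have nIt : ~ I t by apply: tIs; rewrite inE eqxx.
  have [ti0|i0t|ti0] := ltgtP t i0; last by rewrite ti0 in nIt.
  + exists (L `&` K); first by rewrite mem_cat map_f.
    split=> // s Is'; rewrite ltNge; apply/negP => st; apply: nIt.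
    by apply: (II _ _ Is' Ii0); rewrite st ltW.
  + exists (G `&` K); first by rewrite mem_cat [X in _ || X]map_f ?orbT.
    split=> // s Is'; rewrite ltNge; apply/negP => st; apply: nIt.
    by apply: (II _ _ Ii0 Is'); rewrite st ltW.
Qed.

Lemma intervals_inner (a b e : R) (Ks : seq (set R)) : 0 < e ->
  (forall K, K \in Ks -> is_interval K /\ K `<=` `[a, b]) -> disjseq Ks ->
  exists H : seq (R * R), [/\
    forall h, h \in H -> h.1 <= h.2 /\
      exists2 K, K \in Ks & `[h.1, h.2]%classic `<=` K,
    disjseq [seq `[h.1, h.2]%classic | h <- H] &
    (lam [set t | (exists2 K, K \in Ks & K t) /\
        forall h, h \in H -> ~ `[h.1, h.2]%classic t] <= e%:E)%E].
Proof.
elim: Ks e => [e e0 _ _|K Ks IH e e0 KsP].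
  exists [::]; split=> //; apply: (le_trans (y := 0%E)); last by rewrite lee_fin ltW.
  by rewrite -lam0; apply: le_lam => t [[K]].
have e20 : 0 < e / 2 by rewrite divr_gt0.
rewrite /disjseq/= => /andP[/allP KKs dKs].
have [|H [HKs dH lamH]] := IH _ e20 _ dKs.
  by move=> J JKs; apply: KsP; rewrite inE JKs orbT.
have {KsP}[iK Kab] : is_interval K /\ K `<=` `[a, b].
  by apply: KsP; rewrite inE eqxx.
have [K0|/set0P K0] := eqVneq K set0.
  exists H; split=> //.
    move=> h /HKs[hh [J JKs hJ]]; split=> //.
    by exists J => //; rewrite inE JKs orbT.
  apply: le_trans (le_trans lamH _); last by rewrite lee_fin; lra.
  apply: le_lam => t [[J]]; rewrite inE => /predU1P[->|JKs Jt tH].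
    by rewrite K0.
  by split=> //; exists J.
have [c [d [cd Kc Kd lamK]]] := interval_inner iK Kab e20 K0.
have cdK : `[c, d]%classic `<=` K.
  by move=> t /=; rewrite in_itv/= => ctd; exact: (iK _ _ Kc Kd).
exists ((c, d) :: H); split.
- move=> h; rewrite inE => /predU1P[->/=|/HKs[hh [J JKs hJ]]]; split=> //.
    by exists K => //; rewrite inE eqxx.
  by exists J => //; rewrite inE JKs orbT.
- rewrite /disjseq/= -/(disjseq _) dH andbT; apply/allP => _ /mapP[h hH ->].
  have [_ [J JKs hJ]] := HKs _ hH.
  apply/asboolP; apply: disjoint_sub cdK hJ _.
  by apply/asboolP; exact: KKs.
- apply: (@le_trans _ _ (e / 2 + e / 2)%:E); last by rewrite -splitr.
  rewrite EFinD; apply: le_trans (leeD lamK lamH).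
  apply: le_trans (lamU _ _); apply: le_lam => t [[J]].
  rewrite inE => /predU1P[->|JKs Jt tH].
    move=> Kt tH; left; split=> //.
    by apply: (tH (c, d)); rewrite inE eqxx.
  right; split; first by exists J.
  by move=> h hH; apply: tH; rewrite inE hH orbT.
Qed.

End lebesgue_line.
Section segments.
Context {R : realType} {M : metricType R}.
Implicit Types (x y : M) (S : set M) (D : set R) (g : R -> M).

Definition isometric_on D g : Prop :=
  forall s t, D s -> D t -> mdist (g s) (g t) = `|s - t|.

Definition is_segment x y S : Prop :=
  exists (a b : R) g, [/\ a <= b, isometric_on `[a, b] g,
    g a = x, g b = y & g @` `[a, b] = S].

(* In a metric tree the segment exists and is unique (segmentP, segment_eq). *)
Definition segment x y : set M := xget set0 [set S | is_segment x y S].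

(* The isometric parametrization of [x, y] with arc x y 0 = x (see arcP); its
   values outside [0, d(x, y)] are irrelevant, hence the restriction in
   arc_preimage. *)
Definition arc x y : R -> M := xget (fun=> x) [set g |
  [/\ isometric_on `[0, mdist x y] g, g 0 = x &
      g @` `[0, mdist x y] = segment x y]].

Definition arc_preimage x y S : set R :=
  `[0, mdist x y]%classic `&` arc x y @^-1` S.

Definition seg_measure x y S : \bar R :=
  completed_lebesgue_measure (arc_preimage x y S).

Definition disjoint_segments (F : seq (M * M)) : bool :=
  pairwise (fun u v => `[< segment u.1 u.2 `&` segment v.1 v.2 = set0 >]) F.

Definition segs_measure (F : seq (M * M)) S : \bar R :=
  (\sum_(u <- F) seg_measure u.1 u.2 S)%E.

(* Defined for every S, but only countably additive on the measurable sets
   (tree_measure_bigcup). *)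
Definition tree_measure S : \bar R :=
  ereal_sup [set segs_measure F S | F in [set F | disjoint_segments F]].

Definition tree_measurable S : Prop :=
  forall x y, lebesgue_measurable (arc_preimage x y S).

End segments.

HB.mixin Record Metric_isTree (R : realType) T & Metric R T := {
  segment_unique : forall x y : T, exists! S : set T, is_segment x y S ;
  segment_cat : forall x y z : T,
    segment x z `&` segment z y = [set z] ->
    segment x z `|` segment z y = segment x y
}.

#[short(type="metricTreeType")]
HB.structure Definition MetricTree (R : realType) :=
  {T of Metric R T & Metric_isTree R T}.

Section tree_theory.
Context {R : realType} {T : metricTreeType R}.
Implicit Types (x y z u v : T) (S : set T) (g : R -> T) (F G : seq (T * T)).

Lemma segmentP x y : is_segment x y (segment x y).
Proof.
have [S [xyS _]] := segment_unique x y.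
by apply: (@xgetPex _ set0 [set S | is_segment x y S]); exists S.
Qed.

Lemma segment_eq x y S : is_segment x y S -> segment x y = S.
Proof.
move=> xyS; have [S' [_ uS']] := segment_unique x y.
by rewrite -(uS' _ (segmentP x y)) (uS' _ xyS).
Qed.

Lemma segment_isometric (a b : R) g : a <= b -> isometric_on `[a, b] g ->
  segment (g a) (g b) = g @` `[a, b].
Proof. by move=> ab gab; apply: segment_eq; exists a, b, g. Qed.

Lemma segmentC x y : segment x y = segment y x.
Proof.
apply: segment_eq; have [a [b [g [ab gab gay gbx <-]]]] := segmentP y x.
exists (- b), (- a), (g \o -%R).
have oppE (t : R) : `[- b, - a]%classic t = `[a, b]%classic (- t).
  by rewrite /= !in_itv/= lerNl lerNr andbC.
split; rewrite /= ?opprK ?lerN2//.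
  move=> s t; rewrite !oppE => sab tab; rewrite /= gab//.
  by rewrite -opprD normrN.
apply/seteqP; split=> _ [t tab <-].
  by exists (- t) => //; rewrite -oppE.
by exists (- t); rewrite ?oppE/= opprK.
Qed.

Lemma arcP x y : [/\ isometric_on `[0, mdist x y] (arc x y), arc x y 0 = x &
  arc x y @` `[0, mdist x y] = segment x y].
Proof.
apply: (@xgetPex _ (fun=> x) [set g |
  [/\ isometric_on `[0, mdist x y] g, g 0 = x &
      g @` `[0, mdist x y] = segment x y]]).
have [a [b [g [ab gab gax gby gS]]]] := segmentP x y.
have dE : mdist x y = b - a.
  rewrite -gax -gby gab/= ?in_itv/= ?lexx ?ab//.
  by rewrite distrC ger0_norm// subr_ge0.
exists (fun t => g (t + a)).
have addE (t : R) : `[0, mdist x y]%classic t = `[a, b]%classic (t + a).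
  by rewrite /= !in_itv/= dE lerBrDr lerDr.
split; rewrite ?add0r//.
  move=> s t; rewrite !addE => sab tab; rewrite gab//; congr `|_|; lra.
rewrite -gS; apply/seteqP; split=> _ [t tab <-].
  by exists (t + a) => //; rewrite -addE.
by exists (t - a); rewrite ?addE subrK.
Qed.

Lemma arc_isometric x y : isometric_on `[0, mdist x y] (arc x y).
Proof. by have [] := arcP x y. Qed.

Lemma arc0 x y : arc x y 0 = x.
Proof. by have [] := arcP x y. Qed.

Lemma arc_image x y : arc x y @` `[0, mdist x y] = segment x y.
Proof. by have [] := arcP x y. Qed.

Lemma arc_segment x y (t : R) : `[0, mdist x y]%classic t ->
  segment x y (arc x y t).
Proof. by move=> txy; rewrite -arc_image; exists t. Qed.

Lemma mdist_arc x y (t : R) : `[0, mdist x y]%classic t ->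
  mdist x (arc x y t) = t.
Proof.
move=> txy; rewrite -{1}(arc0 x y) arc_isometric//.
  by move: txy; rewrite /= in_itv/= => /andP[t0 _]; rewrite sub0r normrN ger0_norm.
by rewrite /= in_itv/= lexx mdist_ge0.
Qed.

Lemma segment_mdist x y z : segment x y z -> `[0, mdist x y]%classic (mdist x z).
Proof. by rewrite -arc_image => -[t txy <-]; rewrite mdist_arc. Qed.

Lemma arc_mdist x y z : segment x y z -> arc x y (mdist x z) = z.
Proof. by rewrite -arc_image => -[t txy <-]; rewrite mdist_arc. Qed.

Lemma segment_arc x y (s t : R) : `[0, mdist x y]%classic s ->
  `[0, mdist x y]%classic t -> s <= t ->
  segment (arc x y s) (arc x y t) = arc x y @` `[s, t].
Proof.
move=> sxy txy st; apply: segment_isometric => // s' t' s't st'.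
move: sxy txy s't st'; rewrite /= !in_itv/= => /andP[? ?] /andP[? ?] /andP[? ?].
move=> /andP[? ?]; rewrite arc_isometric//= in_itv/=; apply/andP; split; lra.
Qed.

Lemma segment_sub x y u v : segment x y u -> segment x y v ->
  segment u v `<=` segment x y.
Proof.
have sub (s t : R) : `[0, mdist x y]%classic s -> `[0, mdist x y]%classic t ->
    s <= t -> segment (arc x y s) (arc x y t) `<=` segment x y.
  move=> sxy txy st; rewrite segment_arc// -arc_image; apply: image_subset => r.
  move: sxy txy; rewrite /= !in_itv/= => /andP[? ?] /andP[? ?] /andP[? ?].
  apply/andP; split; lra.
rewrite -{1 2}arc_image => -[s sxy <-] [t txy <-].
by have [/ltW st|st] := ltP t s; [rewrite segmentC|]; exact: sub.
Qed.

Lemma arc_preimage_interval x y u v :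
  is_interval (arc_preimage x y (segment u v)).
Proof.
move=> r t [rxy /= ruv] [txy /= tuv] s /andP[rs st].
have sxy : `[0, mdist x y]%classic s.
  move: rxy txy; rewrite /= !in_itv/= => /andP[? ?] /andP[? ?].
  apply/andP; split; lra.
split=> //=; apply: (segment_sub ruv tuv).
rewrite segment_arc// ?(le_trans rs)//; exists s => //.
by rewrite /= in_itv/= rs.
Qed.

Lemma tree_measurable_segment x y : tree_measurable (segment x y).
Proof.
by move=> u v; apply: interval_lebesgue_measurable; exact: arc_preimage_interval.
Qed.

Lemma arc_preimage0 x y : arc_preimage x y set0 = set0.
Proof. by rewrite /arc_preimage preimage_set0 setI0. Qed.

Lemma tree_measurable0 : tree_measurable (set0 : set T).
Proof.
by move=> x y; rewrite arc_preimage0; exact: measurable0.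
Qed.

Lemma tree_measurableC S : tree_measurable S -> tree_measurable (~` S).
Proof.
move=> mS x y.
have -> : arc_preimage x y (~` S) = `[0, mdist x y]%classic `\` arc_preimage x y S.
  by apply/seteqP; split=> t [txy tS]; split=> //; [move=> []|move=> St; apply: tS].
apply: measurableD; last exact: mS.
by apply: interval_lebesgue_measurable; exact: interval_is_interval.
Qed.

Lemma arc_preimage_bigcup x y (F : nat -> set T) :
  arc_preimage x y (\bigcup_n F n) = \bigcup_n arc_preimage x y (F n).
Proof. by rewrite /arc_preimage preimage_bigcup setI_bigcupr. Qed.

Lemma tree_measurable_bigcup (F : nat -> set T) :
  (forall n, tree_measurable (F n)) -> tree_measurable (\bigcup_n F n).
Proof.
move=> mF x y; rewrite arc_preimage_bigcup.
by apply: bigcupT_measurable => n; exact: mF.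
Qed.

End tree_theory.

(* T as a measurable space. A measurableType has to be pointed, and a metric
   tree may be empty: the point is the only role of p, neither the
   sigma-algebra nor the measure depends on it. *)
Definition tree_space (R : realType) (T : metricTreeType R) (p : T) : Type := T.

HB.instance Definition _ (R : realType) (T : metricTreeType R) (p : T) :=
  Choice.on (tree_space p).
HB.instance Definition _ (R : realType) (T : metricTreeType R) (p : T) :=
  isPointed.Build (tree_space p) p.
HB.instance Definition _ (R : realType) (T : metricTreeType R) (p : T) :=
  isMeasurable.Build default_measure_display (tree_space p)
    (@tree_measurable0 R T) (@tree_measurableC R T)
    (@tree_measurable_bigcup R T).
Section tree_measure_theory.
Context {R : realType} {T : metricTreeType R}.
Implicit Types (x y z : T) (S : set T) (F G : seq (T * T)).

Let sg (u : T * T) : set T := segment u.1 u.2.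

Lemma tree_measurableI S1 S2 :
  tree_measurable S1 -> tree_measurable S2 -> tree_measurable (S1 `&` S2).
Proof.
move=> m1 m2 x y; have -> : arc_preimage x y (S1 `&` S2) =
    arc_preimage x y S1 `&` arc_preimage x y S2.
  by rewrite /arc_preimage preimage_setI setIACA setIid.
by apply: measurableI; [exact: m1|exact: m2].
Qed.

Lemma tree_measurableD S1 S2 :
  tree_measurable S1 -> tree_measurable S2 -> tree_measurable (S1 `\` S2).
Proof.
by move=> m1 m2; apply: tree_measurableI => //; exact: tree_measurableC.
Qed.

Lemma seg_measure_ge0 x y S : (0 <= seg_measure x y S)%E.
Proof. exact: lam_ge0. Qed.

Lemma seg_measure0 x y : seg_measure x y set0 = 0%E.
Proof. by rewrite /seg_measure arc_preimage0 lam0. Qed.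

Lemma arc_preimageS x y S1 S2 : S1 `<=` S2 ->
  arc_preimage x y S1 `<=` arc_preimage x y S2.
Proof. by move=> S12 t [txy /S12]. Qed.

Lemma le_seg_measure x y S1 S2 : S1 `<=` S2 ->
  (seg_measure x y S1 <= seg_measure x y S2)%E.
Proof. by move=> S12; apply: le_lam; exact: arc_preimageS. Qed.

Lemma seg_measureU x y S1 S2 :
  (seg_measure x y (S1 `|` S2) <= seg_measure x y S1 + seg_measure x y S2)%E.
Proof. by rewrite /seg_measure /arc_preimage preimage_setU setIUr; exact: lamU. Qed.

Lemma seg_measure_le_mdist x y S : (seg_measure x y S <= (mdist x y)%:E)%E.
Proof.
apply: (@le_trans _ _ (completed_lebesgue_measure `[0, mdist x y])).
  by apply: le_lam => t [].
by rewrite lam_itv ?mdist_ge0// subr0.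
Qed.

Lemma seg_measure_fin x y S : seg_measure x y S \is a fin_num.
Proof.
rewrite ge0_fin_numE ?seg_measure_ge0//.
by rewrite (le_lt_trans (seg_measure_le_mdist _ _ _))// ltry.
Qed.

Lemma seg_measureI x y S : seg_measure x y (S `&` segment x y) = seg_measure x y S.
Proof.
rewrite /seg_measure; congr (completed_lebesgue_measure _).
apply/seteqP; split=> t [txy]; first by move=> [].
by move=> St; split=> //; split=> //; exact: arc_segment.
Qed.

Lemma seg_measureD x y S1 S2 : tree_measurable S1 -> tree_measurable S2 ->
  S1 `&` S2 = set0 ->
  seg_measure x y (S1 `|` S2) = (seg_measure x y S1 + seg_measure x y S2)%E.
Proof.
move=> m1 m2 S120; rewrite /seg_measure.
have -> : arc_preimage x y (S1 `|` S2) = arc_preimage x y S1 `|` arc_preimage x y S2.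
  by rewrite /arc_preimage preimage_setU setIUr.
rewrite measureU//; [exact: m1|exact: m2|].
rewrite -subset0 => t [[_ S1t] [_ S2t]].
by have : (S1 `&` S2) (arc x y t) by []; rewrite S120.
Qed.

Lemma seg_measure_bigcup x y (A : nat -> set T) :
  (forall n, tree_measurable (A n)) -> trivIset setT A ->
  seg_measure x y (\bigcup_n A n) = (\sum_(0 <= n <oo) seg_measure x y (A n))%E.
Proof.
move=> mA tA; rewrite /seg_measure arc_preimage_bigcup measure_bigcup//.
- by apply: eq_eseriesl => n; rewrite in_setT.
- by move=> n _; exact: mA.
- apply/trivIsetP => i j _ _ ij; rewrite -subset0 => t [[_ it] [_ jt]].
  have := trivIsetP.1 tA i j I I ij; rewrite -subset0 => /(_ (arc x y t)); exact.
Qed.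

Lemma seg_measure_exchange x y u v S :
  seg_measure x y (S `&` segment u v) = seg_measure u v (S `&` segment x y).
Proof.
rewrite /seg_measure.
have -> : arc_preimage u v (S `&` segment x y) =
    (fun t => mdist u (arc x y t)) @` arc_preimage x y (S `&` segment u v).
  apply/seteqP; split=> [t [tuv /= [St xyt]]|_ [t [txy /= [St uvt]] <-]].
    exists (mdist x (arc u v t)).
      split; first exact: segment_mdist.
      by rewrite /= arc_mdist//; split=> //; exact: arc_segment.
    by rewrite arc_mdist// mdist_arc.
  split; first exact: segment_mdist.
  by rewrite /= arc_mdist//; split=> //; exact: arc_segment.
apply/esym/lam_isom => s t [sxy /= [_ uvs]] [txy /= [_ uvt]].
rewrite -(arc_isometric (segment_mdist uvs) (segment_mdist uvt)).
by rewrite !arc_mdist// arc_isometric.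
Qed.

Lemma segs_measure_ge0 F S : (0 <= segs_measure F S)%E.
Proof. by apply: sume_ge0 => u _; exact: seg_measure_ge0. Qed.

Lemma segs_measure_cat F G S :
  segs_measure (F ++ G) S = (segs_measure F S + segs_measure G S)%E.
Proof. by rewrite /segs_measure big_cat. Qed.

Lemma segs_measure_cons (u : T * T) F S :
  segs_measure (u :: F) S = (seg_measure u.1 u.2 S + segs_measure F S)%E.
Proof. by rewrite /segs_measure big_cons. Qed.

Lemma le_segs_measure F S1 S2 : S1 `<=` S2 ->
  (segs_measure F S1 <= segs_measure F S2)%E.
Proof. by move=> S12; apply: lee_sum => u _; exact: le_seg_measure. Qed.

Lemma segs_measure_fin F S : segs_measure F S \is a fin_num.
Proof. by apply/sum_fin_numP => u _ _; exact: seg_measure_fin. Qed.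

Lemma segs_measureD F S1 S2 : tree_measurable S1 -> tree_measurable S2 ->
  S1 `&` S2 = set0 ->
  segs_measure F (S1 `|` S2) = (segs_measure F S1 + segs_measure F S2)%E.
Proof.
move=> m1 m2 S120; rewrite /segs_measure -big_split/=.
by apply: eq_bigr => u _; rewrite seg_measureD.
Qed.

Lemma segs_measure_bigcup F (A : nat -> set T) :
  (forall n, tree_measurable (A n)) -> trivIset setT A ->
  segs_measure F (\bigcup_n A n) = (\sum_(0 <= n <oo) segs_measure F (A n))%E.
Proof.
move=> mA tA; rewrite /segs_measure.
rewrite (@nneseries_sum _ F xpredT R (fun (w : T * T) n => seg_measure w.1 w.2 (A n))).
  by apply: eq_bigr => u _; rewrite seg_measure_bigcup.
by move=> *; exact: seg_measure_ge0.
Qed.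

Lemma disjoint_segmentsE F : disjoint_segments F = disjseq (map sg F).
Proof. by rewrite /disjseq pairwise_map. Qed.

Lemma segs_measure_disjoint F G S : disjoint_segments G -> tree_measurable S ->
  (\sum_(u <- G) segs_measure F (S `&` sg u) <= segs_measure F S)%E.
Proof.
elim: G S => [S _ _|u G IH S]; first by rewrite big_nil segs_measure_ge0.
rewrite /disjoint_segments/= => /andP[/allP uG dG] mS; rewrite big_cons.
have mu : tree_measurable (sg u) by exact: tree_measurable_segment.
have -> : segs_measure F S = (segs_measure F (S `&` sg u) +
    segs_measure F (S `\` sg u))%E.
  rewrite -segs_measureD; first by rewrite setUIDK.
  - exact: tree_measurableI.
  - exact: tree_measurableD.
  - by rewrite -subset0 => t [[_ ut] [_]].
rewrite leeD2l// (le_trans _ (IH _ dG (tree_measurableD mS mu)))//.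
rewrite le_eqVlt; apply/orP; left; apply/eqP.
rewrite big_seq [RHS]big_seq; apply: eq_bigr => v vG; congr segs_measure.
have /asboolP uv := uG _ vG.
apply/seteqP; split=> t; last by move=> [[]].
move=> [St vt]; split=> //; split=> // ut.
by have : (sg u `&` sg v) t by []; rewrite uv.
Qed.

Lemma seg_measure_cover x y F (L S : set T) :
  segment x y `<=` L `|` [set t | exists2 w : T * T, w \in F & sg w t] ->
  (seg_measure x y S <= segs_measure F (S `&` segment x y) + seg_measure x y L)%E.
Proof.
move=> xyF.
apply: (@le_trans _ _ (seg_measure x y
    (L `|` [set t | exists2 w : T * T, w \in F & (S `&` sg w) t]))).
  rewrite -seg_measureI; apply: le_seg_measure => t [St /xyF[Lt|[u uF ut]]].
    by left.
  by right; exists u.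
apply: (le_trans (seg_measureU _ _ _ _)); rewrite addeC leeD2r//.
elim: F {xyF} => [|u F IH].
  rewrite /segs_measure big_nil -(seg_measure0 x y).
  by apply: le_seg_measure => t [].
rewrite segs_measure_cons -seg_measure_exchange.
apply: le_trans (leeD (lexx _) IH); apply: le_trans (seg_measureU _ _ _ _).
apply: le_seg_measure => t [v]; rewrite inE => /predU1P[->|vF vt]; first by left.
by right; exists v.
Qed.

(* Disjoint closed segments cannot cover a branching union of segments exactly,
   hence the loss of e. *)
Lemma disjoint_segments_extend F x y (e : R) : 0 < e -> disjoint_segments F ->
  exists G, disjoint_segments (F ++ G) /\
    forall S, (seg_measure x y S <= segs_measure (F ++ G) (S `&` segment x y) + e%:E)%E.
Proof.
move=> e0 dF.
have [I|Ks [Kint Kdisj KsP]] :=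
    @interval_setD R 0 (mdist x y) [seq arc_preimage x y (sg u) | u <- F].
  by move=> /mapP[u _ ->]; exact: arc_preimage_interval.
have Kxy K : K \in Ks -> is_interval K /\ K `<=` `[0, mdist x y].
  move=> KKs; split; first exact: Kint.
  by move=> t Kt; have [] := (KsP t).1 (ex_intro2 _ _ K KKs Kt).
have [H [HKs dH lamH]] := intervals_inner e0 Kxy Kdisj.
pose G := [seq (arc x y h.1, arc x y h.2) | h <- H].
have sgh h : h \in H -> segment (arc x y h.1) (arc x y h.2) =
    arc x y @` `[h.1, h.2].
  move=> hH; have [h12 [K KKs hK]] := HKs _ hH.
  have hxy (t : R) : `[h.1, h.2]%classic t -> `[0, mdist x y]%classic t.
    by move=> /hK; exact: (Kxy _ KKs).2.
  by apply: segment_arc => //; apply: hxy; rewrite /= in_itv/= lexx h12.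
have Hxy h t : h \in H -> `[h.1, h.2]%classic t -> `[0, mdist x y]%classic t /\
    forall w : T * T, w \in F -> ~ sg w (arc x y t).
  move=> hH ht; have [h12 [K KKs hK]] := HKs _ hH.
  have [txy tF] := (KsP t).1 (ex_intro2 _ _ K KKs (hK _ ht)).
  split=> // u uF ut; apply: (tF (arc_preimage x y (sg u))) => //.
  exact: map_f.
have arc_inj s t : `[0, mdist x y]%classic s -> `[0, mdist x y]%classic t ->
    arc x y s = arc x y t -> s = t.
  by move=> sxy txy st; rewrite -(mdist_arc sxy) st mdist_arc.
exists G; split.
  rewrite disjoint_segmentsE map_cat /disjseq pairwise_cat -!/(disjseq _).
  rewrite -disjoint_segmentsE dF/=; apply/andP; split.
    apply/allrelP => _ _ /mapP[u uF ->] /mapP[_ /mapP[h hH ->] ->].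
    apply/asboolP; rewrite -subset0 => z [uz].
    rewrite /sg/= sgh// => -[t ht tz].
    by have [_ /(_ _ uF)] := Hxy _ _ hH ht; rewrite tz.
  rewrite /disjseq !pairwise_map; move: dH; rewrite /disjseq pairwise_map.
  apply: (@sub_in_pairwise _ (mem H)); last by apply/allP.
  move=> h h' hH h'H /asboolP hh'; apply/asboolP.
  rewrite /sg/= (sgh _ hH) (sgh _ h'H) -subset0 => _ [[t ht <-] [t' ht' tt']].
  suff : (`[h.1, h.2]%classic `&` `[h'.1, h'.2]%classic) t by rewrite hh'.
  split=> //; rewrite (arc_inj _ _ _ _ (esym tt'))//.
  - exact: (Hxy _ _ hH ht).1.
  - exact: (Hxy _ _ h'H ht').1.
move=> S.
pose L : set T := arc x y @` [set t | (exists2 K, K \in Ks & K t) /\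
  forall h, h \in H -> ~ `[h.1, h.2]%classic t].
apply: (le_trans (@seg_measure_cover x y (F ++ G) L S _)).
  rewrite -arc_image => _ [t txy <-].
  have [[u uF ut]|nF] := pselect (exists2 w : T * T, w \in F & sg w (arc x y t)).
    by right; exists u => //; rewrite mem_cat uF.
  have [[h hH ht]|nH] := pselect (exists2 h, h \in H & `[h.1, h.2]%classic t).
    right; exists (arc x y h.1, arc x y h.2).
      by rewrite mem_cat [X in _ || X]map_f ?orbT.
    by rewrite /sg/= sgh//; exists t.
  left; exists t => //; split.
    apply/KsP; split=> // _ /mapP[u uF ->] [_ ut]; apply: nF; by exists u.
  by move=> h hH ht; apply: nH; exists h.
rewrite leeD2l//; apply: le_trans lamH; apply: le_lam => t [txy [t' [[K KKs Kt'] tH] tt']].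
suff <- : t' = t by split=> //; exists K.
by apply: arc_inj => //; exact: (Kxy _ KKs).2.
Qed.

Lemma disjoint_segments_extends F G (e : R) : 0 < e -> disjoint_segments F ->
  exists H, disjoint_segments (F ++ H) /\ forall u : T * T, u \in G -> forall S,
    (seg_measure u.1 u.2 S <= segs_measure (F ++ H) (S `&` sg u) + e%:E)%E.
Proof.
move=> e0; elim: G F => [F dF|u G IH F dF].
  by exists [::]; rewrite cats0; split.
have [H1 [dH1 uH1]] := disjoint_segments_extend u.1 u.2 e0 dF.
have [H2 [dH2 GH2]] := IH _ dH1.
exists (H1 ++ H2); rewrite catA; split=> // v; rewrite inE => /predU1P[-> S|vG].
  apply: (le_trans (uH1 S)); rewrite leeD2r// [leRHS]segs_measure_cat.
  by rewrite leeDl// segs_measure_ge0.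
exact: GH2.
Qed.

Lemma segs_measure_le_tree F S : disjoint_segments F ->
  (segs_measure F S <= tree_measure S)%E.
Proof. by move=> dF; apply: ereal_sup_ubound; exists F. Qed.

Lemma le_tree_measure S1 S2 : S1 `<=` S2 -> (tree_measure S1 <= tree_measure S2)%E.
Proof.
move=> S12; apply: ge_ereal_sup => _ [F dF <-].
exact: le_trans (le_segs_measure F S12) (segs_measure_le_tree _ _).
Qed.

Lemma tree_measure_ge0 S : (0 <= tree_measure S)%E.
Proof. exact: (le_trans (segs_measure_ge0 [::] S) (segs_measure_le_tree _ _)). Qed.

Lemma tree_measure0 : tree_measure (set0 : set T) = 0%E.
Proof.
apply/eqP; rewrite eq_le tree_measure_ge0 andbT.
apply: ge_ereal_sup => _ [F dF <-]; rewrite /segs_measure big1// => u _.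
exact: seg_measure0.
Qed.

Lemma segs_measure_superadd F G S1 S2 :
  disjoint_segments F -> disjoint_segments G ->
  tree_measurable S1 -> tree_measurable S2 -> S1 `&` S2 = set0 ->
  (segs_measure F S1 + segs_measure G S2 <= tree_measure (S1 `|` S2))%E.
Proof.
move=> dF dG m1 m2 S120; apply/lee_addgt0Pr => e e0.
pose e' := e / (size G).+1%:R.
have e'0 : 0 < e' by rewrite divr_gt0.
have [H [dH GH]] := disjoint_segments_extends G e'0 dF.
have GE : (segs_measure G S2 <= segs_measure (F ++ H) S2 + e%:E)%E.
  apply: (@le_trans _ _ (\sum_(u <- G) (segs_measure (F ++ H) (S2 `&` sg u) + e'%:E))%E).
    rewrite /segs_measure big_seq [leRHS]big_seq.
    by apply: lee_sum => u uG; exact: GH.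
  rewrite big_split/= leeD//; first exact: segs_measure_disjoint.
  rewrite sumEFin lee_fin big_const_seq count_predT iter_addr_0 -mulr_natl /e' mulrCA ger_pMr//.
  by rewrite ler_pdivrMr// mul1r ler_nat.
apply: (@le_trans _ _ (segs_measure (F ++ H) S1 + (segs_measure (F ++ H) S2 + e%:E))%E).
  by rewrite leeD// segs_measure_cat leeDl// segs_measure_ge0.
by rewrite addeA leeD2r// -segs_measureD// segs_measure_le_tree.
Qed.

Lemma tree_measure_superadd S1 S2 :
  tree_measurable S1 -> tree_measurable S2 -> S1 `&` S2 = set0 ->
  (tree_measure S1 + tree_measure S2 <= tree_measure (S1 `|` S2))%E.
Proof.
move=> m1 m2 S120.
have [->|fin12] := eqVneq (tree_measure (S1 `|` S2)) +oo%E; first exact: leey.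
have fin S : S `<=` S1 `|` S2 -> tree_measure S \is a fin_num.
  move=> SS; rewrite ge0_fin_numE ?tree_measure_ge0//.
  by rewrite (le_lt_trans (le_tree_measure SS))// ltey.
rewrite -leeBrDr; last by apply: fin; exact: subsetUr.
apply: ge_ereal_sup => _ [F dF <-].
rewrite leeBrDr; last by apply: fin; exact: subsetUr.
rewrite addeC -leeBrDr ?segs_measure_fin//.
apply: ge_ereal_sup => _ [G dG <-].
by rewrite leeBrDr ?segs_measure_fin// addeC segs_measure_superadd.
Qed.

Lemma tree_measure_bigcup (A : nat -> set T) :
  (forall n, tree_measurable (A n)) -> trivIset setT A ->
  tree_measure (\bigcup_n A n) = (\sum_(0 <= n <oo) tree_measure (A n))%E.
Proof.
move=> mA tA; apply/eqP; rewrite eq_le; apply/andP; split.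
  apply: ge_ereal_sup => _ [F dF <-]; rewrite segs_measure_bigcup//.
  apply: lee_nneseries => n *; first exact: segs_measure_ge0.
  exact: segs_measure_le_tree.
apply: lime_le.
  by apply: is_cvg_nneseries => n _ _; exact: tree_measure_ge0.
apply: nearW => n; apply: (@le_trans _ _ (tree_measure (\bigcup_(i < n) A i))).
  elim: n => [|n IH]; first by rewrite big_nil tree_measure_ge0.
  rewrite big_nat_recr//= bigcup_mkord big_ord_recr/= -bigcup_mkord.
  apply: le_trans (tree_measure_superadd _ _ _); first by rewrite leeD2r.
  - have -> : \bigcup_(i < n) A i = \bigcup_i (if (i < n)%N then A i else set0).
      apply/seteqP; split=> t [i].
        by move=> /= ilt Ait; exists i => //; rewrite ilt.
      by move=> _; case: ifP => // ilt Ait; exists i.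
    apply: tree_measurable_bigcup => i; case: ifP => // _; exact: tree_measurable0.
  - exact: mA.
  - rewrite -subset0 => t [[i /= ilt Ait] Ant].
    have := trivIsetP.1 tA i n I I; rewrite (ltn_eqF ilt) => /(_ isT).
    by rewrite -subset0 => /(_ t); exact.
by apply: le_tree_measure => t [i _ Ait]; exists i.
Qed.

Lemma tree_measure_segment x y : tree_measure (segment x y) = (mdist x y)%:E.
Proof.
apply/eqP; rewrite eq_le; apply/andP; split; last first.
  apply: le_trans (segs_measure_le_tree (F := [:: (x, y)]) _ _) => //.
  rewrite segs_measure_cons /segs_measure big_nil adde0 /seg_measure.
  rewrite (_ : arc_preimage _ _ _ = `[0, mdist x y]%classic).
    by rewrite lam_itv ?mdist_ge0// subr0.
  by apply/seteqP; split=> [t []//|t txy]; split=> //; exact: arc_segment.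
apply: ge_ereal_sup => _ [F dF <-].
apply: (@le_trans _ _ (segs_measure [:: (x, y)] setT)); last first.
  by rewrite segs_measure_cons /segs_measure big_nil adde0 seg_measure_le_mdist.
apply: le_trans (segs_measure_disjoint [:: (x, y)] dF _); last first.
  by rewrite -setC0; apply: tree_measurableC; exact: tree_measurable0.
apply: lee_sum => u _; rewrite segs_measure_cons /segs_measure big_nil adde0/=.
by rewrite -[segment x y]setTI -seg_measure_exchange setTI.
Qed.

End tree_measure_theory.
Section tree_embedding.
Context {R : realType} {T : metricTreeType R}.

Definition mu_tree (p : T) : set (tree_space p) -> \bar R := @tree_measure R T.
Arguments mu_tree p : clear implicits.

Lemma mu_tree_semi_sigma_additive p : semi_sigma_additive (mu_tree p).
Proof.
move=> A mA tA mUA; rewrite /mu_tree tree_measure_bigcup//.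
by apply: is_cvg_nneseries => n _ _; exact: tree_measure_ge0.
Qed.

HB.instance Definition _ p := isMeasure.Build _ (tree_space p) R (mu_tree p)
  tree_measure0 tree_measure_ge0 (@mu_tree_semi_sigma_additive p).

Definition chi (p x : T) : tree_space p -> R := \1_(segment p x).
Arguments chi p x : clear implicits.

Lemma chi_Lfun p x : chi p x \in Lfun (mu_tree p) 1%E.
Proof.
have mpx : measurable (segment p x : set (tree_space p)).
  exact: tree_measurable_segment.
apply/Lfun1_integrable/integrableP; split.
  apply/measurable_EFinP; exact: measurable_indic.
rewrite (eq_integral (fun t => (chi p x t)%:E)); last first.
  by move=> t _ /=; rewrite ger0_norm.
rewrite integral_indic//= setIT [X in (X < _)%E](tree_measure_segment p x).
exact: ltry.
Qed.

Definition semicanonical (p x : T) : L1 (mu_tree p) :=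
  L1class (Lfun_Sub (lexx 1%E) (chi_Lfun p x)).

Definition contractive_retraction (X : normedModType R) (U : T -> X)
    (r : X -> X) : Prop :=
  [/\ forall a b, `|r a - r b| <= `|a - b|,
      forall a, range U (r a) &
      forall a, range U a -> r a = a].

Definition retraction_points (X : normedModType R) (U : T -> X) (a : X) : set T :=
  [set x0 | exists2 r, contractive_retraction U r & r a = U x0].

End tree_embedding.

Arguments mu_tree {R T} p.
Arguments chi {R T} p x.

(* Main.v *)
(* At every point of T the functions U(x_k) - U(y) have the same sign, so
   |x~ - U(y)| = sum_k alpha_k d(x_k, y), and U is an isometry. Condition (2) thus
   says that sending x~ to x_0 and U(y) to y is 1-Lipschitz on U(T) and x~. Compact
   metric trees are hyperconvex, so this map extends to L_1 by Zorn's lemma. *)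
Require Import Defs.
From mathcomp Require Import all_boot all_order all_algebra.
From mathcomp Require Import all_classical all_reals all_analysis.
From mathcomp Require Import measurable_realfun lra.

Set Implicit Arguments.
Unset Strict Implicit.
Unset Printing Implicit Defensive.

Import Order.TTheory GRing.Theory Num.Theory.
Import numFieldNormedType.Exports.

Local Open Scope classical_set_scope.
Local Open Scope ring_scope.

(** * Branching and medians of segments in a metric tree *)

Section tree_geometry.
Context {R : realType} {T : metricTreeType R}.
Implicit Types x y z m u v w : T.

Lemma mdist_segment x y w : segment x y w -> mdist x w + mdist w y = mdist x y.
Proof.
have arcy : Defs.arc x y (mdist x y) = y.
  have : segment x y y.
    have [a [b [g [ab _ _ <- <-]]]] := segmentP x y.
    by exists b => //=; rewrite in_itv/= ab lexx.
  exact: arc_mdist.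
rewrite -arc_image => -[t /[dup] txy]; rewrite /= in_itv/= => /andP[t0 txy'] <-.
rewrite mdist_arc// -{2}arcy arc_isometric//; last first.
  by rewrite /= in_itv/= mdist_ge0 lexx.
by rewrite distrC ger0_norm ?subr_ge0// addrC subrK.
Qed.

Lemma segment_left x y : segment x y x.
Proof.
by rewrite -{2}(arc0 x y); apply: arc_segment; rewrite /= in_itv/= lexx mdist_ge0.
Qed.

Lemma segment_right x y : segment x y y.
Proof. by rewrite segmentC; exact: segment_left. Qed.

Lemma segment_take x y u v : segment x y u -> segment x y v ->
  mdist x v <= mdist x u -> segment x u v.
Proof.
move=> xyu xyv vu; rewrite -(arc_mdist xyu).
rewrite -{1}(arc0 x y) segment_arc//; last exact: mdist_ge0.
- exists (mdist x v); last exact: arc_mdist.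
  by rewrite /= in_itv/= mdist_ge0.
- by rewrite /= in_itv/= lexx mdist_ge0.
- exact: segment_mdist.
Qed.

Lemma segment_inj x y u v : segment x y u -> segment x y v ->
  mdist x u = mdist x v -> u = v.
Proof. by move=> xyu xyv uv; rewrite -(arc_mdist xyu) uv arc_mdist. Qed.

(** The supremum of [mdist z w] over common points [w] is attained: both arcs from [z] agree at
    parameters arbitrarily close to it and are isometric, so they agree at the supremum too. *)
Lemma branch_point z x y : exists m, [/\ segment z x m, segment z y m &
  forall w, segment z x w -> segment z y w -> mdist z w <= mdist z m].
Proof.
pose D := [set mdist z w | w in segment z x `&` segment z y].
have D0 : D !=set0.
  by exists (mdist z z), z => //; split; exact: segment_left.
have Dub : has_sup D.
  split=> //; exists (mdist z x) => _ [w [xw _] <-].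
  by have := segment_mdist xw; rewrite /= in_itv/= => /andP[].
have Dsup w : segment z x w -> segment z y w -> mdist z w <= sup D.
  by move=> xw yw; apply: ub_le_sup; [case: Dub|exists w].
have s0 : 0 <= sup D.
  by rewrite -(mdistxx z) Dsup//; exact: segment_left.
have sx : `[0, mdist z x]%classic (sup D).
  rewrite /= in_itv/= s0/=; apply: ge_sup => // _ [w [xw _] <-].
  by have := segment_mdist xw; rewrite /= in_itv/= => /andP[].
have sy : `[0, mdist z y]%classic (sup D).
  rewrite /= in_itv/= s0/=; apply: ge_sup => // _ [w [_ yw] <-].
  by have := segment_mdist yw; rewrite /= in_itv/= => /andP[].
have eqxy : Defs.arc z x (sup D) = Defs.arc z y (sup D).
  apply: mdist_positivity; apply/eqP; rewrite eq_le mdist_ge0 andbT.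
  apply/ler_addgt0Pr => e e0; rewrite add0r.
  have e20 : 0 < e / 2 by rewrite divr_gt0.
  have [_ [w [xw yw] <-] we] := sup_adherent e20 Dub.
  rewrite (le_trans (metric_triangle _ w _))//.
  rewrite -{1}(arc_mdist xw) -{2}(arc_mdist yw).
  rewrite !arc_isometric ?segment_mdist//; try exact: segment_mdist.
  rewrite distrC.
  by rewrite ler0_norm ?subr_le0 ?Dsup//; lra.
exists (Defs.arc z x (sup D)); split=> [||w xw yw].
- exact: arc_segment.
- by rewrite eqxy; exact: arc_segment.
- by rewrite mdist_arc// Dsup.
Qed.

(** Take for [m] the branch point of the segments from [z]. A common point of [[x, m]] and [[m, y]]
    is no nearer to [z] than [m], and by maximality no farther, so it is [m]; then [segment_cat]
    puts [m] on [[x, y]]. *)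
Lemma median x y z : exists m,
  [/\ segment z x m, segment z y m & segment x y m].
Proof.
have [m [xm ym mmax]] := branch_point z x y.
exists m; split=> //; rewrite -(@segment_cat _ _ x y m).
  by left; exact: segment_right.
apply/seteqP; split=> w; last first.
  by move=> ->; split; [exact: segment_right|exact: segment_left].
move=> [xmw myw] /=.
have xzm : segment x z m by rewrite segmentC.
have xw : segment z x w.
  by rewrite segmentC; apply: segment_sub xmw => //; exact: segment_left.
have yw : segment z y w.
  by apply: segment_sub myw => //; exact: segment_right.
apply: (segment_inj xw xm); apply/eqP; rewrite eq_le mmax//=.
have := mdist_segment xmw; have := mdist_segment xw; have := mdist_segment xm.
have := metric_sym x w; have := metric_sym x m; have := mdist_ge0 w m.
by move=> *; lra.
Qed.

(** Going from [x] to [y] through a common point [w] has length [d(x, y) + 2 (d(p, m) - d(p, w))],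
    so [w] cannot lie beyond [m]. *)
Lemma segmentI_median p x y m : segment p x m -> segment p y m ->
  segment x y m -> segment p x `&` segment p y = segment p m.
Proof.
move=> xm ym xym; apply/seteqP; split=> w; last first.
  move=> pmw; split; apply: segment_sub pmw => //; exact: segment_left.
move=> [xw yw]; apply: (segment_take xm xw).
have := mdist_segment xw; have := mdist_segment yw.
have := mdist_segment xm; have := mdist_segment ym; have := mdist_segment xym.
have := metric_triangle x w y; have := metric_sym x w; have := metric_sym x m.
by move=> *; lra.
Qed.

(* The first hypothesis says that the Gromov product of [u] and [v] at [y] is
   greater than [s]. *)
Lemma segment_common y u v w (s : R) : mdist u v < mdist y u + mdist y v - 2 * s ->
  segment y u w -> mdist y w <= s -> segment y v w.
Proof.
move=> uvs uw ws; have [m [um vm uvm]] := median u v y.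
have := mdist_segment um; have := mdist_segment vm; have := mdist_segment uvm.
have mC := metric_sym u m => duv dv du.
(* By the three additive relations [mdist y m] is the Gromov product, hence greater than [s]. *)
have := segment_take um uw; have -> : mdist y w <= mdist y m by lra.
move=> /(_ isT); apply: segment_sub => //; exact: segment_left.
Qed.

Lemma segment_point x y (s : R) : 0 <= s <= mdist x y ->
  exists2 w, segment x y w & mdist x w = s.
Proof.
move=> sxy; exists (Defs.arc x y s); first by apply: arc_segment; rewrite /= in_itv.
by rewrite mdist_arc//= in_itv.
Qed.

End tree_geometry.

(** * Hyperconvexity of compact trees and extension of 1-Lipschitz maps *)

Section hyperconvexity.
Context {R : realType} {T : metricTreeType R}.
Context (cT : compact [set: T]).

Lemma lipschitz_continuous (g : T -> R) :
  (forall y z, g y <= g z + mdist y z) -> continuous g.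
Proof.
move=> glip y; apply/cvgrPdist_lt => e e0.
near=> z; have yz : mdist y z < e.
  have : ball y e z by near: z; exact: nbhsx_ballx.
  by rewrite ballEmdist.
have := glip y z; have := glip z y; rewrite (metric_sym z y) => zy yz'.
by rewrite ltr_norml; apply/andP; split; lra.
Unshelve. all: by end_near. Qed.

(* At a minimum [c] of [sup_u (d(u.1, y) - u.2)] with positive value [m], all
   centres [u.1] within [m / 2] of realising the supremum lie in the same
   direction from [c], so moving [c] by [m / 4] in that direction lowers the
   supremum. *)
Lemma balls_common_point (D : set (T * R)) : D !=set0 ->
  (forall u v, D u -> D v -> mdist u.1 v.1 <= u.2 + v.2) ->
  exists y, forall u, D u -> mdist u.1 y <= u.2.
Proof.
move=> [u0 Du0] DD.
pose E y := [set mdist u.1 y - u.2 | u in D].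
have Esup y : has_sup (E y).
  split; first by exists (mdist u0.1 y - u0.2), u0.
  (* Comparing every ball with that of [u0] bounds the supremum even when [D] is infinite. *)
  exists (u0.2 + mdist u0.1 y) => _ [u Du <-].
  have := metric_triangle u.1 u0.1 y; have := DD _ _ Du Du0.
  by move=> *; lra.
pose g y := sup (E y).
have gub y u : D u -> mdist u.1 y - u.2 <= g y.
  by move=> Du; apply: ub_le_sup; [case: (Esup y)|exists u].
have gle y r : (forall u, D u -> mdist u.1 y - u.2 <= r) -> g y <= r.
  by move=> h; apply: ge_sup => [|_ [u Du <-]]; [case: (Esup y)|exact: h].
have /lipschitz_continuous gC y z : g y <= g z + mdist y z.
  apply: gle => u Du; have := gub z _ Du; have := metric_triangle u.1 z y.
  by rewrite (metric_sym z y) => *; lra.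
have [|c _ cmin] := compact_EVT_min _ cT (continuous_subspaceT gC).
  by exists u0.1.
exists c => u Du; rewrite -subr_le0 (le_trans (gub c _ Du))// leNgt.
apply/negP => m0 {u Du}.
set m := g c in m0.
have m20 : 0 < m / 2 by rewrite divr_gt0.
have [_ [u Du <-] um] := sup_adherent m20 (Esup c).
(* With [u] paired with itself the hypothesis makes the radius nonnegative, so [u.1] is farther than
   [m / 2] from [c], which leaves room for a move by [m / 4]. *)
have u20 : 0 <= u.2.
  by have := DD _ _ Du Du; rewrite mdistxx => ?; lra.
rewrite -/(g c) -/m in um.
have uC := metric_sym u.1 c.
have [|w uw wc] := @segment_point _ _ c u.1 (m / 4).
  by apply/andP; split; lra.
(* Values up to [m / 2] grow by at most [m / 4]; larger ones, at most [m], drop by [m / 4]. *)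
suff : g w <= 3 / 4 * m.
  by have := cmin w; rewrite inE => /(_ I); rewrite -/m => *; lra.
apply: gle => v Dv; have vC := metric_sym v.1 c.
have [vm|vm] := lerP (mdist v.1 c - v.2) (m / 2).
  by have := metric_triangle v.1 c w; lra.
have vw : Defs.segment c v.1 w.
  apply: (@segment_common _ _ c u.1 v.1 w (m / 4)) => //; last by rewrite wc.
  by have := DD _ _ Du Dv; lra.
have := mdist_segment vw; have := metric_sym v.1 w; have := gub c _ Dv.
by rewrite -/m; lra.
Qed.

(** A maximal 1-Lipschitz relation is total: over a new point [a], the balls about [u.2] of radius
    [|u.1 - a|] satisfy the hypothesis of [balls_common_point], and a common point can be added as a
    value at [a]. *)
Lemma lipschitz_extension (X : normedModType R) (G : set (X * T)) :
  G !=set0 -> (forall u v, G u -> G v -> mdist u.2 v.2 <= `|u.1 - v.1|) ->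
  exists2 f : X -> T, forall a b, mdist (f a) (f b) <= `|a - b| &
    forall u, G u -> f u.1 = u.2.
Proof.
move=> [u0 Gu0] Glip.
(* Keeping [G] outside [H] lets the empty union, arising from the empty chain, satisfy [P]. *)
pose P (H : set (X * T)) := forall u v, (G `|` H) u -> (G `|` H) v ->
  mdist u.2 v.2 <= `|u.1 - v.1|.
have [F FP Ftot|A [PA Amax]] := @Zorn_bigcup _ P.
  move=> u v [Gu|[H1 FH1 Hu]] [Gv|[H2 FH2 Hv]].
  - exact: Glip.
  - by apply: (FP _ FH2); [left|right].
  - by apply: (FP _ FH1); [right|left].
  - have [H12|H21] := Ftot _ _ FH1 FH2.
      by apply: (FP _ FH2); right => //; exact: H12.
    by apply: (FP _ FH1); right => //; exact: H21.
have Atotal a : exists t, (G `|` A) (a, t).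
  have [||y yP] :=
      @balls_common_point [set (u.2, `|u.1 - a|) | u in G `|` A].
  - by exists (u0.2, `|u0.1 - a|), u0 => //; left.
  - move=> _ _ [u Au <-] [v Av <-] /=; rewrite (le_trans (PA _ _ Au Av))//.
    by rewrite (distrC v.1 a) (le_trans _ (ler_normD _ _))// subrKA.
  have yA u : (G `|` A) u -> mdist u.2 y <= `|u.1 - a|.
    by move=> Au; apply: (yP (u.2, `|u.1 - a|)); exists u.
  exists y; right; apply: contrapT => nAay.
  apply: (Amax (A `|` [set (a, y)])).
    split; first by move=> ? ?; left.
    by move=> /(_ (a, y)) h; apply: nAay; apply: h; right.
  move=> u v; rewrite !setUA => -[Au|->] [Av|->] /=.
  - exact: PA.
  - exact: yA.
  - by rewrite metric_sym distrC; exact: yA.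
  - by rewrite mdistxx.
have [f fA] := choice Atotal.
exists f => [a b|u Gu]; first exact: (PA _ _ (fA a) (fA b)).
(* Two values of the relation over the same [u.1] are at distance zero. *)
apply: mdist_positivity; apply/eqP; rewrite eq_le mdist_ge0 andbT.
have := PA _ _ (fA u.1) (or_introl Gu); rewrite /= subrr normr0; exact.
Qed.

End hyperconvexity.

(** * The L1 distance from a convex combination to a point of the embedded tree *)

Section semicanonical_norm.
Context {R : realType} {T : metricTreeType R} (p : T).
Implicit Types x y : T.

Lemma L1classB (d : measure_display) (S : measurableType d)
    (mu : {measure set S -> \bar R}) (f g : L1fun mu) :
  L1class (f - g) = L1class f - L1class g.
Proof. by apply: (addIr (L1class g)); rewrite -L1classD !subrK. Qed.

Lemma L1class_sum (d : measure_display) (S : measurableType d)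
    (mu : {measure set S -> \bar R}) n (f : 'I_n -> L1fun mu) :
  L1class (\sum_(k < n) f k) = \sum_(k < n) L1class (f k).
Proof.
apply: (big_morph _ (@L1classD _ _ _ mu)).
by rewrite -(subrr 0) L1classB subrr.
Qed.

Lemma L1fun_sumE (d : measure_display) (S : measurableType d)
    (mu : {measure set S -> \bar R}) n (f : 'I_n -> L1fun mu) t :
  (\sum_(k < n) f k) t = \sum_(k < n) f k t.
Proof. exact: (big_morph (fun g : L1fun mu => g t)). Qed.

Let measurable_segment x : measurable (segment p x : set (tree_space p)).
Proof. exact: tree_measurable_segment. Qed.

Let symdiff x y : set (tree_space p) :=
  (segment p x `\` segment p y) `|` (segment p y `\` segment p x).

Let measurable_symdiff x y : measurable (symdiff x y).
Proof. by apply: measurableU; exact: measurableD. Qed.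

(** With [m] the median of [x], [y] and [p], the two differences are [[p, x]] and [[p, y]] with
    [[p, m]] removed; their measures [d(m, x)] and [d(m, y)] add up along [[x, y]]. *)
Lemma mu_tree_symdiff x y : mu_tree p (symdiff x y) = (mdist x y)%:E.
Proof.
have [m [xm ym xym]] := median x y p.
have muD z w : segment p z m -> segment p z `&` segment p w = segment p m ->
    mu_tree p (segment p z `\` segment p w) = (mdist m z)%:E.
  move=> zm zwm; rewrite -[LHS](@addeK _ (mdist p m)%:E)//.
  rewrite -{1}(tree_measure_segment p m) -{1}zwm.
  rewrite -(@measureDI _ _ _ (mu_tree p))//.
  rewrite [X in (X - _)%E](tree_measure_segment p z).
  by rewrite -(mdist_segment zm) -EFinB addrAC subrr add0r.
have xyI := segmentI_median xm ym xym.
rewrite measureU; last 1 first.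
- by apply/seteqP; split=> t // -[[? ?] [? ?]].
- rewrite [X in (X + _)%E]muD// [X in (_ + X)%E]muD//; last by rewrite setIC.
  by rewrite -EFinD (metric_sym m x) mdist_segment.
- exact: measurableD.
- exact: measurableD.
Qed.

(* At a given point the differences [chi p (x k) - chi p y] are all nonpositive
   or all nonnegative, according to the value of [chi p y], so no cancellation
   occurs in their combination. *)
Lemma convex_chi_norm n (x : 'I_n -> T) (alpha : 'I_n -> R) y t :
  (forall k, 0 <= alpha k) -> \sum_(k < n) alpha k = 1 ->
  `|\sum_(k < n) alpha k * chi p (x k) t - chi p y t| =
  \sum_(k < n) alpha k * \1_(symdiff (x k) y) t.
Proof.
(* As the weights sum to one, [chi p y t] can be distributed over the terms. *)
move=> a0 a1; rewrite -[X in _ - X]mul1r -a1 mulr_suml -sumrB.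
have indE z : \1_(symdiff z y) t = (-1) ^+ (t \in segment p y) * (chi p z t - chi p y t).
  rewrite /chi !indicE in_setU !in_setD.
  by case: (t \in segment p z); case: (t \in segment p y); rewrite /= ?expr0 ?expr1; lra.
have : \sum_(k < n) alpha k * \1_(symdiff (x k) y) t =
    (-1) ^+ (t \in segment p y) * \sum_(k < n) (alpha k * chi p (x k) t - alpha k * chi p y t).
  by rewrite mulr_sumr; apply: eq_bigr => k _; rewrite indE mulrCA mulrBr.
set S := (X in `|X|) => S_eq.
have : 0 <= (-1) ^+ (t \in segment p y) * S.
  by rewrite -S_eq; apply: sumr_ge0 => k _; rewrite mulr_ge0// indicE.
by rewrite S_eq => /ger0_norm <-; rewrite normrM normr_sign mul1r.
Qed.

(** Integrating [convex_chi_norm] term by term turns each symmetric difference into a distance. *)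
Lemma semicanonical_convex_norm n (x : 'I_n -> T) (alpha : 'I_n -> R) y :
  (forall k, 0 <= alpha k) -> \sum_(k < n) alpha k = 1 ->
  `|\sum_(k < n) alpha k *: semicanonical p (x k) - semicanonical p y| =
  \sum_(k < n) alpha k * mdist (x k) y.
Proof.
move=> a0 a1.
pose f z : L1fun (mu_tree p) := Lfun_Sub (lexx 1%E) (chi_Lfun p z).
(* An explicit representative of the class makes the norm the integral of a known function. *)
have -> : \sum_(k < n) alpha k *: semicanonical p (x k) - semicanonical p y =
    L1class (\sum_(k < n) alpha k *: f (x k) - f y).
  rewrite L1classB L1class_sum; congr (_ - _).
  by apply: eq_bigr => k _; rewrite -L1scale_class.
rewrite [LHS]L1norm_class Lnorm1.
rewrite (eq_integral (fun t => \sum_(k < n) (alpha k)%:E * (\1_(symdiff (x k) y) t)%:E)%E).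
  rewrite ge0_integral_sum.
  - rewrite (eq_bigr (fun k => (alpha k * mdist (x k) y)%:E)); first by rewrite sumEFin.
    move=> k _; rewrite ge0_integralZl_EFin.
    + by rewrite integral_indic// setIT [X in (_ * X)%E]mu_tree_symdiff.
    + exact: measurableT.
    + by move=> t _; rewrite lee_fin indicE.
    + exact/measurable_EFinP/measurable_indic.
    + exact: a0.
  - exact: measurableT.
  - move=> k; apply: measurable_funeM; exact/measurable_EFinP/measurable_indic.
  - by move=> k t _; rewrite -EFinM lee_fin mulr_ge0// indicE.
move=> t _ /=; under [RHS]eq_bigr do rewrite -EFinM.
rewrite [RHS]sumEFin -convex_chi_norm//; congr (`| _ - _ |%:E).
exact: (L1fun_sumE (fun k => alpha k *: f (x k))).
Qed.

End semicanonical_norm.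

(** This is the convex combination of a single point with weight one. *)
Lemma semicanonical_isometric (R : realType) (T : metricTreeType R) (p x y : T) :
  `|semicanonical p x - semicanonical p y| = mdist x y.
Proof.
have := @semicanonical_convex_norm R T p 1 (fun=> x) (fun=> 1) y.
by rewrite !big_ord1 scale1r mul1r; apply.
Qed.

(** * Retractions sending the convex combination to a prescribed point *)

Theorem theorem4p4 (R : realType) (T : metricTreeType R) (p : T) (n : nat)
    (x : 'I_n -> T) (alpha : 'I_n -> R) (x0 : T) :
  compact [set: T] ->
  (forall k, 0 < alpha k) -> \sum_(k < n) alpha k = 1 ->
  retraction_points (semicanonical p)
    (\sum_(k < n) alpha k *: semicanonical p (x k)) x0 <->
  (forall y : T, mdist x0 y <= \sum_(k < n) alpha k * mdist (x k) y).
Proof.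
move=> cT a_gt0 a1.
have a0 k : 0 <= alpha k by exact: ltW.
set U := semicanonical p; set xt := \sum_(k < n) _ *: _.
have xtU y : `|xt - U y| = \sum_(k < n) alpha k * mdist (x k) y.
  exact: semicanonical_convex_norm.
split=> [[r [rlip _ rU] rx] y|x0le].
  (* The retraction sends [xt] to [U x0] and fixes [U y], so it cannot increase their distance. *)
  rewrite -xtU -(semicanonical_isometric p x0 y) -/U -rx -{1}(rU (U y)); last by exists y.
  exact: rlip.
(* If [xt] is itself some [U y], the assumed inequality at [y] forces [x0 = y], so [G] stays
   single-valued. *)
pose G := (xt, x0) |` range (fun y => (U y, y)).
have [||f flip fG] := @lipschitz_extension _ _ cT _ G.
- by exists (xt, x0); left.
- move=> _ _ [->|[y _ <-]] [->|[z _ <-]] /=.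
  + by rewrite mdistxx.
  + by rewrite xtU.
  + by rewrite metric_sym distrC xtU.
  + by rewrite semicanonical_isometric.
(* Since [U] is an isometry, [U \o f] inherits the Lipschitz bound of [f]. *)
exists (U \o f); last by rewrite /= (fG (xt, x0))//; left.
split=> [a b|a|_ [y _ <-]] /=.
- by rewrite semicanonical_isometric.
- by exists (f a).
- by rewrite (fG (U y, y))//; right; exists y.
Qed.
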